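(* Let $f:\mathbb{R}^m\to\mathbb{R}$ be convex and $(M,\nu)$-Hölder smooth on $\mathbb{R}^m$ with $M>0$, $\nu\in[0,1]$, and consider $p^*=\min_{y\in\mathbb{R}^n}\{p(y)=f(Ay)+g(y)\}$ in the setting of the context, with $D>0$. For an integer $K\ge1$ and $\eta>0$, run the first-order primal-dual splitting method of the context for $K$ iterations with $\eta_k\equiv\eta$ and $\rho_k=\frac{4\eta}{k+1}$ for all $k\ge0$, and let $\bar y_K$ be its weighted-average output. If $\nu\in[0,1)$, then for any constant $c>0$: $$p(\bar y_K)-p^*\le\left(125cD^2+12M^{\frac{2}{1-\nu}}c^{-\frac{1+\nu}{1-\nu}}\right)K^{-\frac{1+\nu}{2}},\quad\forall K\ge1,\qquad\text{if }\eta=cK^{\frac{1-\nu}{2}},$$ $$p(\bar y_K)-p^*\le\left(125c+12c^{-\frac{1+\nu}{1-\nu}}\right)MD^{\nu+1}K^{-\frac{1+\nu}{2}},\quad\forall K\ge1,\qquad\text{if }\eta=cK^{\frac{1-\nu}{2}}MD^{\nu-1}.$$ If $\nu=1$, then for any constant $c\ge1$, choosing $\eta=cM$, $$p(\bar y_K)-p^*\le\frac{125cMD^2}{K+3},\quad\forall K\ge1.$$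
   Context: $\|\cdot\|$ is the Euclidean norm. Setting: $A:\mathbb{R}^n\to\mathbb{R}^m$ is linear; $g:\mathbb{R}^n\to\mathbb{R}\cup\{+\infty\}$ is proper, closed and convex; for every $\lambda\in\mathbb{R}^n$ the problem $\min_{y\in\mathbb{R}^n}\{\langle\lambda,y\rangle+g(y)\}$ has an optimal solution; the set $A(\mathrm{dom}\,g)$ is bounded, and $D:=\sup_{x,z\in A(\mathrm{dom}\,g)}\|x-z\|<+\infty$. A convex $f:\mathbb{R}^m\to\mathbb{R}$ is $(M,\nu)$-Hölder smooth on $\mathbb{R}^m$ if $0\le f(x)-f(z)-\langle s_z,x-z\rangle\le\frac{M}{1+\nu}\|x-z\|^{1+\nu}$ for all $x,z\in\mathbb{R}^m$ and all $s_z\in\partial f(z)$. First-order primal-dual splitting method with positive parameters $\{\eta_k\}_{k\ge0},\{\rho_k\}_{k\ge0}$: choose any $y_0\in\mathrm{dom}\,g$, set $x_0=Ay_0$ and $\lambda_0\in\partial f(x_0)$; for $k=0,1,2,\dots$: (i) $y_{k+1}\in\arg\min_{y\in\mathbb{R}^n}\,g(y)+\langle\lambda_k,Ay\rangle$; (ii) choose $s_k\in\partial f(x_k)$; (iii) $x_{k+1}=\arg\min_{x\in\mathbb{R}^m}\langle s_k-\lambda_k,x\rangle+\frac{\eta_k}{2}\|x-x_k\|^2+\frac{\rho_k}{2}\|Ay_{k+1}-x\|^2$; (iv) $\lambda_{k+1}=\lambda_k+\rho_k(Ay_{k+1}-x_{k+1})$. All choices among minimizers and subgradients are arbitrary. The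 output after $K$ iterations is $\bar y_K:=\frac{\sum_{i=0}^{K-1}\alpha_iy_{i+1}}{\sum_{i=0}^{K-1}\alpha_i}$ with $\alpha_i=i+2$. *)

(* Defs.v *)
From HB Require Import structures.
From mathcomp Require Import all_boot all_order all_algebra.
From mathcomp Require Import all_classical all_reals all_analysis.
Set Implicit Arguments.
Unset Strict Implicit.
Unset Printing Implicit Defensive.
Import Order.TTheory GRing.Theory Num.Theory.
Import numFieldNormedType.Exports.
Local Open Scope classical_set_scope.
Local Open Scope ring_scope.

Definition dotp (R : realType) (n : nat) (u v : 'rV[R]_n) : R :=
  \sum_(i < n) u 0 i * v 0 i.

(* The norm `|x| provided by the library on 'rV[R]_n is the sup norm, hence
   this separate Euclidean norm; both induce the same topology and the same
   bounded sets. *)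
Definition enorm (R : realType) (n : nat) (u : 'rV[R]_n) : R :=
  Num.sqrt (dotp u u).

Definition argmin (T : Type) (d : Order.disp_t) (V : porderType d)
    (F : T -> V) : set T :=
  [set x | forall z, (F x <= F z)%O].

Definition edom (R : realType) (T : Type) (g : T -> \bar R) : set T :=
  [set y | (g y < +oo)%E].

Definition proper_fun (R : realType) (T : Type) (g : T -> \bar R) : Prop :=
  (forall y, (-oo < g y)%E) /\ edom g !=set0.

Definition epigraph (R : realType) (n : nat) (g : 'rV[R]_n -> \bar R) :
    set ('rV[R]_n * R^o) :=
  [set yt | (g yt.1 <= yt.2%:E)%E].

Definition closed_fun (R : realType) (n : nat) (g : 'rV[R]_n -> \bar R) :
    Prop :=
  closed (epigraph g).

(* Convexity of the epigraph avoids any reading of products such as 0 * +oo. *)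
Definition convex_efun (R : realType) (n : nat) (g : 'rV[R]_n -> \bar R) :
    Prop :=
  @convex_set R ('rV[R]_n * R^o)%type (epigraph g).

Definition diameter (R : realType) (m : nat) (S : set 'rV[R]_m) : \bar R :=
  ereal_sup [set (enorm (xz.1 - xz.2))%:E | xz in S `*` S].

Definition subdiff (R : realType) (m : nat) (f : 'rV[R]_m -> R)
    (z : 'rV[R]_m) : set 'rV[R]_m :=
  [set s | forall x, f z + dotp s (x - z) <= f x].

Definition holder_smooth (R : realType) (m : nat) (M nu : R)
    (f : 'rV[R]_m -> R) : Prop :=
  forall x z s : 'rV[R]_m, subdiff f z s ->
    0 <= f x - f z - dotp s (x - z) <= M / (1 + nu) * enorm (x - z) `^ (1 + nu).

Definition primal_obj (R : realType) (n m : nat)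
    (A : {linear 'rV[R]_n -> 'rV[R]_m}) (f : 'rV[R]_m -> R)
    (g : 'rV[R]_n -> \bar R) (y : 'rV[R]_n) : \bar R :=
  ((f (A y))%:E + g y)%E.

(* [K] iterations; entries of the sequences that the iterations do not
   produce are unconstrained. *)
Definition primal_dual_run (R : realType) (n m : nat)
    (A : {linear 'rV[R]_n -> 'rV[R]_m}) (f : 'rV[R]_m -> R)
    (g : 'rV[R]_n -> \bar R) (eta rho : nat -> R) (K : nat)
    (y : nat -> 'rV[R]_n) (x lambda s : nat -> 'rV[R]_m) : Prop :=
  [/\ edom g (y 0%N), x 0%N = A (y 0%N), subdiff f (x 0%N) (lambda 0%N) &
    forall k, (k < K)%N ->
    [/\ argmin (fun v => (g v + (dotp (lambda k) (A v))%:E)%E) (y k.+1),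
        subdiff f (x k) (s k),
        argmin (fun u => dotp (s k - lambda k) u
                         + eta k / 2 * enorm (u - x k) ^+ 2
                         + rho k / 2 * enorm (A (y k.+1) - u) ^+ 2)
               (x k.+1) &
        lambda k.+1 = lambda k + rho k *: (A (y k.+1) - x k.+1)]].

Definition weighted_output (R : realType) (n : nat) (K : nat)
    (y : nat -> 'rV[R]_n) : 'rV[R]_n :=
  (\sum_(i < K) (i + 2)%:R)^-1 *: \sum_(i < K) (i + 2)%:R *: y i.+1.

(* Main.v *)
(* Fix y in dom g, put a = A y and abar = A ybar, and take a subgradient l of f
   at abar.  Step (iii) gives lambda_(k+1) = s_k + eta (x_(k+1) - x_k), so the
   multipliers are perturbed subgradients of f at the iterates.  Minorizing
   f (x_k) by its strengthened linearization at abar, and f (a) by its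
   linearization at x_k, bounds f (abar) + g (y_(k+1)) - p (y), up to a term
   that averages to zero, by an expression in e_k = l - lambda_k, q_k = x_k - a and
   w_k = a - A y_(k+1).  Multiplied by k + 2, that expression is at most the
   decrease of
     (k + 1)(k + 2) |e_k|^2 / (8 eta) + eta (k + 2) |q_k|^2 / 2
   plus 4 eta D^2, so the sum over k is O(eta K D^2), against a total weight
   K (K + 3) / 2.  Hoelder smoothness enters only through Young's inequality
   M r^(1+nu) / (1+nu) <= eta r^2 / 2 + delta, which adds an error O(delta). *)
Require Import Defs.
From HB Require Import structures.
From mathcomp Require Import all_boot all_order all_algebra.
From mathcomp Require Import all_classical all_reals all_analysis.
From mathcomp Require Import ring lra.
Set Implicit Arguments.
Unset Strict Implicit.
Unset Printing Implicit Defensive.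
Import Order.TTheory GRing.Theory Num.Theory.
Import numFieldNormedType.Exports.
Local Open Scope classical_set_scope.
Local Open Scope ring_scope.

(** * Bilinearity and positivity of the Euclidean inner product *)

Section DotProduct.
Variables (R : realType) (m : nat).
Implicit Types u v w : 'rV[R]_m.

Lemma dotpC u v : dotp u v = dotp v u.
Proof. by apply: eq_bigr => i _; rewrite mulrC. Qed.

Lemma dotpDl u v w : dotp (u + v) w = dotp u w + dotp v w.
Proof. by rewrite -big_split; apply: eq_bigr => i _; rewrite mxE mulrDl. Qed.

Lemma dotpZl a u v : dotp (a *: u) v = a * dotp u v.
Proof. by rewrite mulr_sumr; apply: eq_bigr => i _; rewrite mxE mulrA. Qed.

Lemma dotpNl u v : dotp (- u) v = - dotp u v.
Proof. by rewrite -scaleN1r dotpZl mulN1r. Qed.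

Lemma dotpDr u v w : dotp u (v + w) = dotp u v + dotp u w.
Proof. by rewrite dotpC dotpDl !(dotpC u). Qed.

Lemma dotpZr a u v : dotp u (a *: v) = a * dotp u v.
Proof. by rewrite dotpC dotpZl dotpC. Qed.

Lemma dotpNr u v : dotp u (- v) = - dotp u v.
Proof. by rewrite dotpC dotpNl dotpC. Qed.

Lemma dotp0 u : dotp u 0 = 0.
Proof. by rewrite -(scale0r 0) dotpZr mul0r. Qed.

Lemma dotp_sumr (I : Type) (r : seq I) u (F : I -> 'rV[R]_m) :
  dotp u (\sum_(i <- r) F i) = \sum_(i <- r) dotp u (F i).
Proof. exact: (big_morph _ (dotpDr u) (dotp0 u)). Qed.

Lemma dotp_ge0 u : 0 <= dotp u u.
Proof. by apply: sumr_ge0 => i _; rewrite -expr2 sqr_ge0. Qed.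

Lemma dotp_delta u i : dotp u (delta_mx 0 i) = u 0 i.
Proof.
rewrite /dotp (bigD1 i) //= big1 => [|j ji].
  by rewrite mxE !eqxx mulr1 addr0.
by rewrite mxE (negbTE ji) andbF mulr0.
Qed.

Lemma dotp_eq0 u : dotp u u <= 0 -> u = 0.
Proof.
move=> u0; have: dotp u u == 0 by rewrite eq_le u0 dotp_ge0.
rewrite psumr_eq0 => [/allP uE|i _]; last by rewrite -expr2 sqr_ge0.
apply/rowP => i; rewrite mxE; apply/eqP.
by have := uE i; rewrite mem_index_enum /= mulf_eq0 orbb; apply.
Qed.

Lemma enorm_sqr u : enorm u ^+ 2 = dotp u u.
Proof. by rewrite sqr_sqrtr // dotp_ge0. Qed.

End DotProduct.

(** * Jensen's inequality for weighted averages *)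

Section Convexity.
Variable R : realType.

Lemma convex_set_combine (V : lmodType R) (S : set V) (u v : V) (a b : R) :
  @convex_set R V S -> S u -> S v -> 0 <= a -> 0 <= b -> a + b = 1 ->
  S (a *: u + b *: v).
Proof.
move=> cS Su Sv a0 b0 ab.
have a1 : a <= 1 by rewrite -ab lerDl.
have := cS u v (Itv01 a0 a1); rewrite !inE => /(_ Su Sv).
by rewrite /conv /= /unstable.onem -ab [a + b - a]addrC addKr.
Qed.

(** Induction on the number of points: adding a point turns the average into a two-point combination
    of the old average, with weight [s / (s + a K.+1)], and the new point. *)
Lemma convex_set_wavg (V : lmodType R) (S : set V) (a : nat -> R)
    (v : nat -> V) (K : nat) :
  @convex_set R V S -> (forall i, 0 < a i) ->
  (forall i, (i < K.+1)%N -> S (v i)) ->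
  S ((\sum_(i < K.+1) a i)^-1 *: \sum_(i < K.+1) a i *: v i).
Proof.
move=> cS a0; elim: K => [|K IH] Sv.
  by rewrite !big_ord1 scalerA mulVf ?gt_eqF // scale1r; exact: Sv.
rewrite big_ord_recr [X in _ *: X]big_ord_recr /=.
set s := \sum_(i < K.+1) a i; set z := \sum_(i < K.+1) a i *: v i.
have s0 : 0 < s.
  by rewrite /s big_ord_recl ltr_pwDl // sumr_ge0 // => i _; exact: ltW.
have t0 : 0 < s + a K.+1 by rewrite addr_gt0.
have -> : (s + a K.+1)^-1 *: (z + a K.+1 *: v K.+1) =
    (s / (s + a K.+1)) *: (s^-1 *: z) + (a K.+1 / (s + a K.+1)) *: v K.+1.
  rewrite scalerDr !scalerA; congr (_ *: _ + _ *: _); last by rewrite mulrC.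
  by field; rewrite !gt_eqF.
apply: convex_set_combine => //.
- by apply: IH => i iK; apply: Sv; rewrite ltnS ltnW.
- exact: Sv.
- by rewrite divr_ge0 // ltW.
- by rewrite divr_ge0 // ltW.
- by rewrite -mulrDl divff // gt_eqF.
Qed.

(** The pairs [(y i, G i)] lie in the epigraph, hence so does their average; real bounds [G i] keep
    infinite values out of the sums. *)
Lemma convex_efun_wavg (n : nat) (g : 'rV[R]_n -> \bar R) (a G : nat -> R)
    (y : nat -> 'rV[R]_n) (K : nat) :
  convex_efun g -> (forall i, 0 < a i) ->
  (forall i, (i < K.+1)%N -> (g (y i) <= (G i)%:E)%E) ->
  (g ((\sum_(i < K.+1) a i)^-1 *: \sum_(i < K.+1) a i *: y i) <=
    ((\sum_(i < K.+1) a i)^-1 * \sum_(i < K.+1) a i * G i)%:E)%E.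
Proof.
move=> cg a0 yG.
have := @convex_set_wavg ('rV[R]_n * R^o)%type (epigraph g) a
  (fun i => (y i, G i)) K cg a0 yG.
rewrite /epigraph /=.
have -> : \sum_(i < K.+1) a i *: ((y i, G i) : 'rV[R]_n * R^o) =
    (\sum_(i < K.+1) a i *: y i, \sum_(i < K.+1) a i * G i).
  by elim: K.+1 => [|k IH]; rewrite ?big_ord0 // !big_ord_recr /= IH.
by [].
Qed.

Lemma convex_fun_combine (V : lmodType R) (f : V -> R) (u v : V) (a b : R) :
  @convex_function R V setT f -> 0 <= a -> 0 <= b -> a + b = 1 ->
  f (a *: u + b *: v) <= a * f u + b * f v.
Proof.
move=> cf a0 b0 ab.
have a1 : a <= 1 by rewrite -ab lerDl.
have /= := cf (Itv01 a0 a1) u v (mem_set Logic.I) (mem_set Logic.I).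
by rewrite convRE /conv /= /unstable.onem -ab [a + b - a]addrC addKr.
Qed.

End Convexity.

(** * Existence of subgradients of a finite convex function *)

Section Subgradient.
Variables (R : realType) (m : nat) (f : 'rV[R]_m -> R).
Hypothesis f_convex : @convex_function R 'rV[R]_m setT f.

(* Finite-dimensional Hahn-Banach: a minorant of f along the first k
   coordinate directions extends to one more direction, because every slope
   to the left is at most every slope to the right. *)
Lemma convex_partial_subgradient (z : 'rV[R]_m) (k : nat) : (k <= m)%N ->
  exists s, forall d : 'rV[R]_m, (forall i : 'I_m, (k <= i)%N -> d 0 i = 0) ->
    f z + dotp s d <= f (z + d).
Proof.
elim: k => [_|k IH km].
  exists 0 => d d0; have -> : d = 0 by apply/rowP => i; rewrite mxE d0.
  by rewrite dotp0 !addr0.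
have [s Hs] := IH (ltnW km).
pose i0 := Ordinal km; pose E : 'rV[R]_m := delta_mx 0 i0.
pose low (d : 'rV[R]_m) := forall i : 'I_m, (k <= i)%N -> d 0 i = 0.
pose slopeL (u : 'rV[R]_m) (t : R) := (f z + dotp s u - f (z + u - t *: E)) / t.
pose slopeR (u : 'rV[R]_m) (t : R) := (f (z + u + t *: E) - f z - dotp s u) / t.
(* The weights [a] and [b] cancel the [E] components of the two points, so their combination is a
   [low] displacement of [z], where the minorant of the induction hypothesis applies. *)
have LR u (t : R) u' (t' : R) : low u -> 0 < t -> low u' -> 0 < t' ->
    slopeL u t <= slopeR u' t'.
  move=> lu t0 lu' t'0; have T0 : 0 < t + t' by rewrite addr_gt0.
  set a := t' / (t + t'); set b := t / (t + t').
  have a0 : 0 <= a by rewrite divr_ge0 // ltW.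
  have b0 : 0 <= b by rewrite divr_ge0 // ltW.
  have ab : a + b = 1 by rewrite /a /b; field; rewrite gt_eqF.
  have := convex_fun_combine (z + u - t *: E) (z + u' + t' *: E)
    f_convex a0 b0 ab.
  have -> : a *: (z + u - t *: E) + b *: (z + u' + t' *: E) =
      z + (a *: u + b *: u').
    apply/rowP => i; rewrite !mxE /a /b; field; rewrite gt_eqF //.
  have lc : low (a *: u + b *: u').
    by move=> i ki; rewrite !mxE lu // lu' // !mulr0 addr0.
  have := Hs _ lc; rewrite dotpDr !dotpZr => H1 H2.
  have {H1 H2} := ler_wpM2l (ltW T0) (le_trans H1 H2).
  rewrite !mulrDr !mulrA.
  rewrite ![(t + t') * _ / _]mulrAC divff ?gt_eqF // !mul1r.
  move=> H; rewrite /slopeL /slopeR ler_pdivrMr // mulrAC ler_pdivlMr //.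
  by lra.
pose SL := [set r | exists u (t : R), [/\ low u, 0 < t & r = slopeL u t]].
have low0 : low 0 by move=> i _; rewrite mxE.
have SL0 : SL !=set0 by exists (slopeL 0 1); exists 0, 1; split.
have SLub u (t : R) : low u -> 0 < t -> ubound SL (slopeR u t).
  by move=> lu t0 _ [u' [t' [lu' t'0 ->]]]; exact: LR.
pose c := sup SL.
have cL u (t : R) : low u -> 0 < t -> slopeL u t <= c.
  move=> lu t0; apply: ub_le_sup; last by exists u, t; split.
  by exists (slopeR 0 1); exact: SLub.
have cR u (t : R) : low u -> 0 < t -> c <= slopeR u t.
  by move=> lu t0; apply: ge_sup => //; exact: SLub.
(* The new vector is [s] with its coordinate [i0] replaced by the separating slope [c]. *)
exists (s + (c - s 0 i0) *: E) => d ld.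
pose tau : R := d 0 i0; pose u := d - tau *: E.
have lu : low u.
  move=> i ki; rewrite /u /tau !mxE eqxx /=.
  have [->|ne] := eqVneq i i0; first by rewrite mulr1 subrr.
  rewrite mulr0 subr0 ld // ltn_neqAle ki andbT; apply: contra ne => /eqP ik.
  exact/eqP/val_inj.
have -> : dotp (s + (c - s 0 i0) *: E) d = dotp s u + c * tau.
  rewrite dotpDl dotpZl [dotp E d]dotpC dotp_delta -/tau /u.
  by rewrite dotpDr dotpNr dotpZr dotp_delta; ring.
have dE : d = u + tau *: E by rewrite /u subrK.
rewrite dE [z + (u + _)]addrA; case: (ltrgtP tau 0) => [t0|t0|->].
- have nt0 : 0 < - tau by rewrite oppr_gt0.
  have := cL u (- tau) lu nt0.
  by rewrite /slopeL ler_pdivrMr // scaleNr opprK; lra.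
- by have := cR u tau lu t0; rewrite /slopeR ler_pdivlMr //; lra.
- by rewrite mulr0 scale0r !addr0; exact: Hs.
Qed.

Lemma convex_subdiff_neq0 (z : 'rV[R]_m) : subdiff f z !=set0.
Proof.
have [s Hs] := convex_partial_subgradient z (leqnn m).
exists s => x; have := Hs (x - z); rewrite subrKC; apply => i.
by rewrite leqNgt ltn_ord.
Qed.

End Subgradient.

(* An upper quadratic model of f with an additive error delta, i.e. an
   inexact oracle in the sense of Devolder, Glineur and Nesterov. *)
Definition upper_model (R : realType) (m : nat) (f : 'rV[R]_m -> R)
    (eta delta : R) : Prop :=
  forall x z s : 'rV[R]_m, subdiff f z s ->
    f x <= f z + dotp s (x - z) + eta / 2 * dotp (x - z) (x - z) + delta.

(** * Consequences of the inexact upper model *)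

Section UpperModel.
Variables (R : realType) (m : nat) (f : 'rV[R]_m -> R) (eta delta : R).
Hypotheses (eta_gt0 : 0 < eta) (fM : upper_model f eta delta).

(* Compare the minorant at z with the majorant at x in the point
   x + (r - s) / eta, which minimizes their difference. *)
Lemma upper_model_strong (x z r s : 'rV[R]_m) :
  subdiff f z r -> subdiff f x s ->
  f z + dotp r (x - z) + (2 * eta)^-1 * dotp (r - s) (r - s) <= f x + delta.
Proof.
move=> zr xs; pose h := eta^-1 *: (r - s).
have := le_trans (zr (x + h)) (fM (x + h) xs).
have -> : x + h - z = (x - z) + h by rewrite addrAC.
have -> : x + h - x = h by rewrite addrC addKr.
rewrite dotpDr.
have -> : dotp h h = (eta^-1) ^+ 2 * dotp (r - s) (r - s).
  by rewrite dotpZl dotpZr mulrA.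
have rs : dotp r h = dotp s h + eta^-1 * dotp (r - s) (r - s).
  by rewrite -dotpZr -/h -dotpDl subrKC.
have -> : eta / 2 * (eta^-1 ^+ 2 * dotp (r - s) (r - s)) =
    (2 * eta)^-1 * dotp (r - s) (r - s) by field; rewrite gt_eqF.
have -> : dotp r h = dotp s h + 2 * ((2 * eta)^-1 * dotp (r - s) (r - s)).
  by rewrite rs; congr (_ + _); field; rewrite gt_eqF.
by lra.
Qed.

(** The strengthened minorant and the upper model at [z] share the same linear part, which cancels.
    This serves to bound the initial multiplier error. *)
Lemma subgradient_dist (x z r s : 'rV[R]_m) :
  subdiff f z r -> subdiff f x s ->
  dotp (r - s) (r - s) <= eta ^+ 2 * dotp (x - z) (x - z) + 4 * eta * delta.
Proof.
move=> zr xs; have H1 := upper_model_strong zr xs; have H2 := fM x zr.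
have : (2 * eta)^-1 * dotp (r - s) (r - s) <=
    eta / 2 * dotp (x - z) (x - z) + 2 * delta by lra.
by rewrite mulrC ler_pdivrMr ?mulr_gt0 //; lra.
Qed.

End UpperModel.

(** * Optimality in step (iii) and the decrease of the potential *)

(** No derivative is taken: the objective is quadratic with Hessian [eta + rho] times the identity,
    so moving from [u] by [- t *: G] with [t = (eta + rho)^-1] lowers it by [t / 2] times the
    squared norm of the gradient [G]. Minimality forces [G = 0]. *)
Lemma quadratic_argmin_grad (R : realType) (m : nat) (c xk b u : 'rV[R]_m)
    (eta rho : R) : 0 < eta -> 0 < rho ->
  argmin (fun u => dotp c u + eta / 2 * enorm (u - xk) ^+ 2
                   + rho / 2 * enorm (b - u) ^+ 2) u ->
  c + eta *: (u - xk) - rho *: (b - u) = 0.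
Proof.
move=> eta0 rho0 umin; set a := u - xk; set d := b - u.
have aE : a = u - xk by []; have dE : d = b - u by [].
set G := c + _ - _; have GE : G = c + eta *: a - rho *: d by [].
clearbody G a d; pose t := (eta + rho)^-1.
have s0 : 0 < eta + rho by rewrite addr_gt0.
have := umin (u - t *: G); rewrite !enorm_sqr.
have -> : u - t *: G - xk = a - t *: G by rewrite aE addrAC.
have -> : b - (u - t *: G) = d + t *: G by rewrite dE opprB addrCA addrC.
rewrite -aE -dE !(dotpDl, dotpDr, dotpNl, dotpNr, dotpZl, dotpZr).
rewrite (dotpC G a) (dotpC G d).
have GG : dotp G G = dotp c G + eta * dotp a G - rho * dotp d G.
  by rewrite {1}GE !(dotpDl, dotpNl, dotpZl).
have tE : (eta + rho) * t = 1 by rewrite /t divff // gt_eqF.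
have t0 : 0 < t by rewrite invr_gt0.
move=> H; apply: dotp_eq0.
have {}H : 0 <= - t * dotp G G + (eta + rho) * t * (t / 2 * dotp G G).
  by rewrite {1}GG; lra.
move: H; rewrite tE mul1r => H.
by rewrite -(pmulr_rle0 _ t0); lra.
Qed.

(** The potential inequality separates over coordinates; this is one coordinate, with [t] standing
    for [k + 1]. *)
Lemma step_coordinate (R : realType) (eta t e e' p q q' w : R) :
  0 < eta -> 1 <= t ->
  q' = q + (p - e') / eta -> e - e' = - (4 * eta / t) * (q' + w) ->
  (t + 1) * (- (e * w) - p * q - (2 * eta)^-1 * (p * p)) <=
    t * (t + 1) / (8 * eta) * (e * e) + eta * (t + 1) / 2 * (q * q)
    - ((t + 1) * (t + 1 + 1) / (8 * eta) * (e' * e')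
       + eta * (t + 1 + 1) / 2 * (q' * q'))
    + 4 * eta * (w * w).
Proof.
move=> eta0 t1 q'E eE; have t0 : 0 < t by lra.
have pE : p = e' + eta * (q' - q) by rewrite q'E; field; rewrite gt_eqF.
have {}eE : e = e' - 4 * eta / t * (q' + w) by lra.
(* Once [p] and [e] are eliminated, the slack is a diagonal quadratic form in [e'], [q'] and [w];
   [1 <= t] makes its last coefficient nonnegative. *)
rewrite -subr_ge0 [X in 0 <= X](_ : _ =
    (t + 1) / (4 * eta) * (e' * e') + eta * (3 * t + 4) / (2 * t) * (q' * q')
    + 2 * eta * (t - 1) / t * (w * w)); last first.
  by rewrite pE eE; field; rewrite !gt_eqF.
have sq (z : R) : 0 <= z * z by rewrite -expr2 sqr_ge0.
by rewrite !addr_ge0 // mulr_ge0 // divr_ge0 ?mulr_ge0 //; lra.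
Qed.

Section Telescope.
Variable R : realType.

(* Under the weight k + 2 the strong convexity term of step k pays for the
   growth of the coefficient of dotp e e from k to k + 1. *)
Definition potential (m : nat) (eta : R) (k : nat) (e q : 'rV[R]_m) : R :=
  (k + 1)%:R * (k + 2)%:R / (8 * eta) * dotp e e
  + eta * (k + 2)%:R / 2 * dotp q q.

Lemma potential_ge0 (m : nat) (eta : R) (k : nat) (e q : 'rV[R]_m) :
  0 < eta -> 0 <= potential eta k e q.
Proof.
move=> eta0; rewrite addr_ge0 // mulr_ge0 ?dotp_ge0 //.
  by rewrite divr_ge0 ?mulr_ge0 // ltW.
by rewrite divr_ge0 ?mulr_ge0 // ltW.
Qed.

Lemma potential_step (m : nat) (eta : R) (k : nat)
    (e e' p q q' w : 'rV[R]_m) :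
  0 < eta -> q' = q + eta^-1 *: (p - e') ->
  e - e' = - (4 * eta / (k + 1)%:R) *: (q' + w) ->
  (k + 2)%:R * (- dotp e w - dotp p q - (2 * eta)^-1 * dotp p p) <=
    potential eta k e q - potential eta k.+1 e' q' + 4 * eta * dotp w w.
Proof.
move=> eta0 q'E eE; rewrite /potential /dotp -!sumrN !mulr_sumr -!sumrN.
rewrite -!big_split mulr_sumr -sumrN -!big_split; apply: ler_sum => i _ /=.
have := @step_coordinate R eta (k + 1)%:R (e 0 i) (e' 0 i) (p 0 i) (q 0 i)
  (q' 0 i) (w 0 i) eta0.
have -> : (k + 2)%:R = (k + 1)%:R + 1 :> R by rewrite !natrD; ring.
have -> : (k.+1 + 1)%:R = (k + 1)%:R + 1 :> R by rewrite addSn natr1.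
have -> : (k.+1 + 2)%:R = (k + 1)%:R + 1 + 1 :> R.
  by rewrite -addn1 !natrD; ring.
apply.
- by rewrite ler1n addn1.
- by rewrite q'E !mxE mulrC.
- by have := congr1 (fun v : 'rV_m => v 0 i) eE; rewrite !mxE.
Qed.

End Telescope.

Lemma weight_sum (R : realType) (K : nat) :
  \sum_(i < K) (i + 2)%:R = K%:R * (K%:R + 3) / 2 :> R.
Proof.
elim: K => [|K IH]; first by rewrite big_ord0 !mul0r.
by rewrite big_ord_recr /= IH -addn1 !natrD; field.
Qed.

(** * The primal gap of a run under an upper model *)

Section Run.
Variables (R : realType) (n m : nat) (A : {linear 'rV[R]_n -> 'rV[R]_m}).
Variables (g : 'rV[R]_n -> \bar R) (f : 'rV[R]_m -> R).
Variables (eta delta D : R) (K : nat).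
Variables (y : nat -> 'rV[R]_n) (x lambda s : nat -> 'rV[R]_m).
Hypotheses (g_proper : proper_fun g) (g_convex : convex_efun g).
Hypothesis f_convex : @convex_function R 'rV[R]_m setT f.
Hypotheses (eta_gt0 : 0 < eta) (delta_ge0 : 0 <= delta).
Hypothesis f_model : upper_model f eta delta.
Hypothesis dom_diam : forall u v, edom g u -> edom g v ->
  dotp (A u - A v) (A u - A v) <= D ^+ 2.
Hypothesis K_gt0 : (0 < K)%N.
Hypothesis run : primal_dual_run A f g (fun=> eta)
  (fun k => 4 * eta / (k + 1)%:R) K y x lambda s.

Let G u := fine (g u).

Lemma edomE u : edom g u -> g u = (G u)%:E.
Proof. by move=> gu; rewrite fineK // fin_numElt gu (g_proper.1 u). Qed.

(** Comparison with a point of finite value makes the minimum in step (i) finite, so the inequality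
    can be read in the reals. *)
Lemma run_oracle k v : (k < K)%N -> edom g v ->
  edom g (y k.+1) /\
  G (y k.+1) + dotp (lambda k) (A (y k.+1)) <= G v + dotp (lambda k) (A v).
Proof.
case: run => _ _ _ /[apply] -[/(_ v) + _ _ _] gv; rewrite /= => H.
have gy : edom g (y k.+1).
  have fin : (dotp (lambda k) (A (y k.+1)))%:E \is a fin_num by [].
  rewrite /edom /= -(lteD2rE _ _ fin).
  by apply: le_lt_trans H _; rewrite (edomE gv) -EFinD ltry.
by split => //; move: H; rewrite (edomE gv) (edomE gy) -!EFinD lee_fin.
Qed.

Lemma run_edom k : (k <= K)%N -> edom g (y k).
Proof.
case: k => [_|k kK]; first by case: run.
by have [v gv] := g_proper.2; have [] := run_oracle kK gv.
Qed.

(** The stationarity condition of step (iii) expresses the increment of step (iv) through [s k] and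
    the move of [x]. *)
Lemma run_multiplier k : (k < K)%N ->
  lambda k.+1 = s k + eta *: (x k.+1 - x k).
Proof.
case: run => _ _ _ /[apply] -[_ _ /quadratic_argmin_grad xmin ->].
have rho0 : 0 < 4 * eta / (k + 1)%:R :> R.
  by rewrite divr_gt0 ?mulr_gt0 // ltr0n addn1.
have /eqP := xmin eta_gt0 rho0; rewrite subr_eq0 => /eqP <-.
by rewrite addrA subrKC.
Qed.

Let ybar := weighted_output K y.
Let S : R := \sum_(i < K) (i + 2)%:R.

Lemma weight_gt0 : 0 < S.
Proof.
by rewrite /S weight_sum divr_gt0 ?mulr_gt0 ?ltr0n ?addr_gt0 ?ltr0n.
Qed.

Lemma ybar_le : (g ybar <= (S^-1 * \sum_(i < K) (i + 2)%:R * G (y i.+1))%:E)%E.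
Proof.
rewrite /ybar /weighted_output /S; have := run_edom; case: K K_gt0 => // k _ ed.
apply: (@convex_efun_wavg _ _ g (fun i => (i + 2)%:R) (fun i => G (y i.+1))
  (fun i => y i.+1)) => // i ik.
by rewrite edomE //; exact: ed.
Qed.

Lemma ybar_edom : edom g ybar.
Proof. by rewrite /edom /=; apply: le_lt_trans ybar_le _; rewrite ltry. Qed.

(** By linearity [A ybar] is the weighted mean of the [A (y k.+1)], so the weighted deviations
    cancel. *)
Lemma ybar_balance (l : 'rV[R]_m) :
  \sum_(k < K) (k + 2)%:R * dotp l (A ybar - A (y k.+1)) = 0.
Proof.
under eq_bigr do rewrite -dotpZr.
rewrite -dotp_sumr; under eq_bigr do rewrite scalerBr.
rewrite sumrB -scaler_suml -/S /ybar /weighted_output linearZ /= -/S scalerA.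
rewrite mulfV ?gt_eqF ?weight_gt0 // scale1r linear_sum.
by under [X in _ - X]eq_bigr do rewrite -linearZ; rewrite subrr dotp0.
Qed.

Lemma run_step (v : 'rV[R]_n) (l : 'rV[R]_m) (k : nat) :
  edom g v -> subdiff f (A ybar) l -> (k < K)%N ->
  (k + 2)%:R * (f (A ybar) - f (A v) - G v + G (y k.+1)
                - dotp l (A ybar - A (y k.+1)) - delta) <=
    potential eta k (l - lambda k) (x k - A v)
    - potential eta k.+1 (l - lambda k.+1) (x k.+1 - A v) + 4 * eta * D ^+ 2.
Proof.
move=> gv fl kK; have [gy oracle] := run_oracle kK gv.
have lE := run_multiplier kK.
case: run => _ _ _ /(_ k kK) [_ fs _ lE'].
set e := l - lambda k; set e' := l - lambda k.+1; set p := l - s k.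
set q := x k - A v; set q' := x k.+1 - A v; set w := A v - A (y k.+1).
have q'E : q' = q + eta^-1 *: (p - e').
  rewrite (_ : p - e' = eta *: (x k.+1 - x k)).
    rewrite scalerA mulVf ?gt_eqF // scale1r.
    by apply/rowP => i; rewrite !mxE; ring.
  by rewrite /p /e' lE; apply/rowP => i; rewrite !mxE; ring.
have eE : e - e' = - (4 * eta / (k + 1)%:R) *: (q' + w).
  by rewrite /e /e' lE'; apply/rowP => i; rewrite !mxE; ring.
have step := potential_step eta_gt0 q'E eE.
have I1 := upper_model_strong eta_gt0 f_model fl fs.
have I2 := fs (A v).
have wD : dotp w w <= D ^+ 2 by exact: dom_diam.
(* Sum of [I1], [I2] and [oracle]; the value [f (x k)] cancels and the linear terms regroup around
   [A v]. *)
have I : f (A ybar) - f (A v) - G v + G (y k.+1)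
    - dotp l (A ybar - A (y k.+1)) - delta <=
    - dotp e w - dotp p q - (2 * eta)^-1 * dotp p p.
  move: I1 I2 oracle; rewrite -/p /e /w /q {2}/p.
  rewrite !(dotpDl, dotpDr, dotpNl, dotpNr); lra.
apply: le_trans (ler_wpM2l (ler0n _ _) I) _; apply: le_trans step _.
by rewrite lerD2l ler_pM2l // mulr_gt0.
Qed.

Lemma run_telescope (v : 'rV[R]_n) (l : 'rV[R]_m) (j : nat) :
  edom g v -> subdiff f (A ybar) l -> (j <= K)%N ->
  \sum_(k < j) (k + 2)%:R * (f (A ybar) - f (A v) - G v + G (y k.+1)
                - dotp l (A ybar - A (y k.+1)) - delta) <=
    potential eta 0 (l - lambda 0) (x 0 - A v)
    - potential eta j (l - lambda j) (x j - A v) + j%:R * (4 * eta * D ^+ 2).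
Proof.
move=> gv fl; elim: j => [_|j IH jK].
  by rewrite big_ord0 subrr mul0r addr0.
rewrite big_ord_recr /= -natr1 mulrDl mul1r.
by have := IH (ltnW jK); have := run_step gv fl jK; lra.
Qed.

Lemma run_gap (v : 'rV[R]_n) :
  (primal_obj A f g ybar <= primal_obj A f g v +
    (21 / 2 * eta * D ^+ 2 / (K + 3)%:R + 3 / 2 * delta)%:E)%E.
Proof.
have [gv|] := boolP (g v < +oo)%E; last first.
  by rewrite -leNgt leye_eq /primal_obj => /eqP ->; rewrite addeC leey.
have [l fl] := convex_subdiff_neq0 f_convex (A ybar).
have gyb := ybar_edom; have S0 := weight_gt0.
rewrite /primal_obj (edomE gv) (edomE gyb) -!EFinD lee_fin.
have := ybar_le; rewrite (edomE gyb) lee_fin mulrC ler_pdivlMr // => yb.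
have := run_telescope gv fl (leqnn K).
set c := f (A ybar) - f (A v) - G v.
rewrite (_ : \sum_(k < K) _ = (c - delta) * S +
    \sum_(k < K) (k + 2)%:R * G (y k.+1) -
    \sum_(k < K) (k + 2)%:R * dotp l (A ybar - A (y k.+1))); last first.
  rewrite /S mulr_sumr -sumrN -!big_split; apply: eq_bigr => k _ /=; ring.
rewrite ybar_balance subr0 => tele.
(* The multiplier part contributes 1/4 of [eta * D ^+ 2] plus [delta], the primal part one more
   [eta * D ^+ 2]. Both use that [x 0] is the image of a point of the domain. *)
have Psi0 : potential eta 0 (l - lambda 0) (x 0 - A v) <=
    5 / 4 * (eta * D ^+ 2) + delta.
  have [y0 x0 fl0 _] := run.
  have := subgradient_dist eta_gt0 f_model fl fl0.
  have := dom_diam y0 gyb; have := dom_diam y0 gv; rewrite -x0 => d1 d2 d3.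
  rewrite /potential; set e2 := dotp (l - _) _ in d3 *.
  have {}d3 : e2 <= eta * (eta * D ^+ 2 + 4 * delta).
    apply: le_trans d3 _; rewrite mulrDr mulrA -expr2.
    rewrite [4 * eta * _]mulrAC [eta * (4 * _)]mulrC lerD2r.
    by rewrite ler_wpM2l // sqr_ge0.
  have -> : (0 + 1)%:R * (0 + 2)%:R / (8 * eta) * e2 = e2 / eta / 4.
    by rewrite !add0n; field; rewrite gt_eqF.
  have {d3} : e2 / eta <= eta * D ^+ 2 + 4 * delta.
    by rewrite ler_pdivrMr // mulrC.
  have : eta * dotp (x 0%N - A v) (x 0%N - A v) <= eta * D ^+ 2.
    by rewrite ler_pM2l.
  by rewrite add0n; lra.
have PsiK := potential_ge0 K (l - lambda K) (x K - A v) eta_gt0.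
have SE : S = K%:R * (K%:R + 3) / 2 by exact: weight_sum.
have K1 : 1 <= K%:R :> R by rewrite ler1n.
have S2 : 2 <= S by rewrite SE; nra.
have etaD : 0 <= eta * D ^+ 2 by rewrite mulr_ge0 ?sqr_ge0 // ltW.
(* Here 21/4 is 5/4 from the initial potential plus 4 per step, using [1 <= K]; 3/2 is 1 plus the
   initial [delta], at most [S * delta / 2] since [2 <= S]. *)
have bound : S * (c + G ybar) <=
    21 / 4 * (K%:R * (eta * D ^+ 2)) + 3 / 2 * (S * delta).
  have : eta * D ^+ 2 <= K%:R * (eta * D ^+ 2) by rewrite ler_peMl.
  have : 2 * delta <= S * delta by rewrite ler_wpM2r.
  by lra.
have : c + G ybar <= 21 / 2 * eta * D ^+ 2 / (K + 3)%:R + 3 / 2 * delta.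
  rewrite -(ler_pM2l S0); apply: le_trans bound _; rewrite SE natrD.
  rewrite le_eqVlt; apply/orP; left; apply/eqP; field.
  by rewrite gt_eqF // addr_gt0 // ltr0n.
by rewrite /c; lra.
Qed.

End Run.

(** * Upper models from Hölder smoothness *)

(** Young's inequality with conjugate exponents [2 / (1 + nu)] and [2 / (1 - nu)], the product being
    split so that the first factor raised to its exponent is [eta * r ^+ 2]. *)
Lemma young_powR (R : realType) (M nu eta r : R) :
  0 < M -> 0 <= nu < 1 -> 0 < eta -> 0 <= r ->
  M / (1 + nu) * r `^ (1 + nu) <= eta / 2 * r ^+ 2 +
    2^-1 * (M `^ (2 / (1 - nu)) * eta `^ (- ((1 + nu) / (1 - nu)))).
Proof.
move=> M0 /andP[nu0 nu1] eta0 r0; set B := M `^ _ * _.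
have B0 : 0 <= B by rewrite mulr_ge0 // powR_ge0.
have n1 : 0 < 1 + nu by lra.
have n2 : 0 < 1 - nu by lra.
have e2 : 0 <= eta `^ 2^-1 * r by rewrite mulr_ge0 // powR_ge0.
have := @conjugate_powR R ((eta `^ 2^-1 * r) `^ (1 + nu))
  (M * eta `^ (- ((1 + nu) / 2))) (2 / (1 + nu)) (2 / (1 - nu)).
rewrite powR_ge0 mulr_ge0 ?powR_ge0 ?(ltW M0) // !divr_gt0 //.
have -> : (2 / (1 + nu))^-1 + (2 / (1 - nu))^-1 = 1.
  by field; rewrite !gt_eqF.
move=> /(_ isT isT isT isT erefl).
have -> : ((eta `^ 2^-1 * r) `^ (1 + nu)) `^ (2 / (1 + nu)) = eta * r ^+ 2.
  rewrite -powRrM mulrCA divff ?gt_eqF // mulr1 powR_mulrn // exprMn.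
  rewrite -[(_ `^ _) ^+ _]powR_mulrn ?powR_ge0 // -powRrM mulVf //.
  by rewrite powRr1 // ltW.
have -> : (M * eta `^ (- ((1 + nu) / 2))) `^ (2 / (1 - nu)) = B.
  rewrite powRM ?powR_ge0 ?(ltW M0) // -powRrM /B; congr (_ * _ `^ _).
  by field; rewrite gt_eqF.
have -> : (eta `^ 2^-1 * r) `^ (1 + nu) * (M * eta `^ (- ((1 + nu) / 2))) =
    M * r `^ (1 + nu).
  rewrite powRM ?powR_ge0 // -powRrM powRN [2^-1 * _]mulrC.
  by field; rewrite gt_eqF // powR_gt0.
rewrite !invf_div => H.
rewrite mulrAC ler_pdivrMr // mulrDl; apply: le_trans H _.
(* This relaxes the exact coefficient [(1 - nu) / (2 * (1 + nu))] of [B] to 1/2. *)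
have : 0 <= nu * B by rewrite mulr_ge0.
by lra.
Qed.

Lemma holder_upper_model (R : realType) (m : nat) (M nu eta : R)
    (f : 'rV[R]_m -> R) :
  0 < M -> 0 <= nu < 1 -> 0 < eta -> holder_smooth M nu f ->
  upper_model f eta
    (2^-1 * (M `^ (2 / (1 - nu)) * eta `^ (- ((1 + nu) / (1 - nu))))).
Proof.
move=> M0 nu01 eta0 fH x z s /(fH x) /andP[_ fx].
have := young_powR M0 nu01 eta0 (sqrtr_ge0 (dotp (x - z) (x - z))).
by rewrite -/(enorm (x - z)) enorm_sqr; lra.
Qed.

(** For exponent 1 the smoothness bound is already quadratic, so the model is exact. *)
Lemma lipschitz_upper_model (R : realType) (m : nat) (M eta : R)
    (f : 'rV[R]_m -> R) :
  M <= eta -> holder_smooth M 1 f -> upper_model f eta 0.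
Proof.
move=> Meta fH x z s /(fH x) /andP[_].
rewrite (_ : 1 + 1 = 2%:R) // powR_mulrn ?sqrtr_ge0 // enorm_sqr => fx.
have : M * dotp (x - z) (x - z) <= eta * dotp (x - z) (x - z).
  by rewrite ler_wpM2r ?dotp_ge0.
by lra.
Qed.

(** * From the gap to the stated rates *)

Lemma dotp_le_diameter (R : realType) (m : nat) (S : set 'rV[R]_m) (D : R) u v :
  D%:E = diameter S -> 0 < D -> S u -> S v -> dotp (u - v) (u - v) <= D ^+ 2.
Proof.
move=> DS D0 Su Sv; rewrite -enorm_sqr.
rewrite ler_pXn2r ?nnegrE ?sqrtr_ge0 ?(ltW D0) //.
by rewrite -lee_fin DS; apply: ereal_sup_ubound; exists (u, v).
Qed.

(** The infimum is squeezed between [F u - b] and [F u], hence finite, and the subtraction is one of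
    reals. *)
Lemma sub_ereal_inf_le (R : realType) (T : Type) (F : T -> \bar R) (u : T)
    (b : R) :
  F u \is a fin_num -> (forall v, F u <= F v + b%:E)%E ->
  (F u - ereal_inf (range F) <= b%:E)%E.
Proof.
move=> Fu Fb.
have lb : (F u - b%:E <= ereal_inf (range F))%E.
  by apply: le_ereal_inf_tmp => _ [v _ <-]; rewrite leeBlDr.
have ub : (ereal_inf (range F) <= F u)%E by apply: ereal_inf_lbound; exists u.
move: Fu lb ub; case: (F u) => [r _|//|//].
by case: (ereal_inf _) => [i||] //=; rewrite -!EFinB !lee_fin; lra.
Qed.

Theorem corollary3p2 (R : realType) (n m : nat)
  (A : {linear 'rV[R]_n -> 'rV[R]_m})
  (g : 'rV[R]_n -> \bar R)
  (g_proper : proper_fun g) (g_closed : closed_fun g) (g_convex : convex_efun g)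
  (g_solvable : forall l : 'rV[R]_n,
     argmin (fun y => ((dotp l y)%:E + g y)%E) !=set0)
  (Adom_bounded : bounded_set (A @` edom g))
  (D : R) (D_def : D%:E = diameter (A @` edom g)) (D_gt0 : 0 < D)
  (f : 'rV[R]_m -> R) (f_convex : convex_function setT f)
  (M nu : R) (M_gt0 : 0 < M) (nu_ge0 : 0 <= nu) (nu_le1 : nu <= 1)
  (f_smooth : holder_smooth M nu f)
  (K : nat) (K_ge1 : (1 <= K)%N) (eta : R) (eta_gt0 : 0 < eta)
  (y : nat -> 'rV[R]_n) (x lambda s : nat -> 'rV[R]_m)
  (run : primal_dual_run A f g (fun=> eta) (fun k => 4 * eta / (k + 1)%:R) K
           y x lambda s) :
  let p := primal_obj A f g in
  let pstar := ereal_inf (range p) in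
  let ybar := weighted_output K y in
  (nu < 1 -> forall c : R, 0 < c ->
    (eta = c * K%:R `^ ((1 - nu) / 2) ->
      (p ybar - pstar <=
        ((125 * c * D ^+ 2
          + 12 * M `^ (2 / (1 - nu)) * c `^ (- ((1 + nu) / (1 - nu))))
         * K%:R `^ (- ((1 + nu) / 2)))%:E)%E) /\
    (eta = c * K%:R `^ ((1 - nu) / 2) * M * D `^ (nu - 1) ->
      (p ybar - pstar <=
        ((125 * c + 12 * c `^ (- ((1 + nu) / (1 - nu))))
         * M * D `^ (nu + 1) * K%:R `^ (- ((1 + nu) / 2)))%:E)%E)) /\
  (nu = 1 -> forall c : R, 1 <= c -> eta = c * M ->
    (p ybar - pstar <= (125 * c * M * D ^+ 2 / (K + 3)%:R)%:E)%E).
Proof.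
move=> p pstar ybar.
have diam u v : edom g u -> edom g v -> dotp (A u - A v) (A u - A v) <= D ^+ 2.
  by move=> gu gv; apply: dotp_le_diameter D_def D_gt0 _ _; [exists u|exists v].
have pfin : p ybar \is a fin_num.
  have gy := ybar_edom g_proper g_convex K_ge1 run.
  by rewrite /p /primal_obj (edomE g_proper gy).
(* The constants 21/2 and 3/2 are relaxed to 125 and 24; as [delta] carries a factor 1/2 for
   [nu < 1], 24 becomes the 12 of the statement. *)
have gap delta b : 0 <= delta -> upper_model f eta delta ->
    125 * eta * D ^+ 2 / (K + 3)%:R + 24 * delta <= b ->
    (p ybar - pstar <= b%:E)%E.
  move=> delta0 fM bE; apply: sub_ereal_inf_le => // v.
  apply: le_trans (run_gap g_proper g_convex f_convex eta_gt0 delta0 fM diam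
    K_ge1 run v) _.
  rewrite leeD2l // lee_fin; apply: le_trans bE.
  have : 0 <= eta * D ^+ 2 / (K + 3)%:R.
    by rewrite divr_ge0 // mulr_ge0 ?sqr_ge0 // ltW.
  by lra.
have K0 : 0 < K%:R :> R by rewrite ltr0n.
split=> [nu1 c c0|nu1 c c1 etaE]; last first.
  apply: (gap 0) => //; last by rewrite etaE mulr0 addr0 [125 * (c * M)]mulrA.
  apply: (@lipschitz_upper_model _ _ M); last by rewrite -nu1.
  by rewrite etaE ler_peMl // ltW.
have nu01 : 0 <= nu < 1 by rewrite nu_ge0.
have := holder_upper_model M_gt0 nu01 eta_gt0 f_smooth.
set delta := _ * _ => fM.
have delta0 : 0 <= delta by rewrite !mulr_ge0 ?invr_ge0 ?powR_ge0.
have Kpow : K%:R `^ ((1 - nu) / 2) / (K + 3)%:R <= K%:R `^ (- ((1 + nu) / 2)).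
  rewrite ler_pdivrMr ?ltr0n ?addn_gt0 ?orbT //.
  have -> : (1 - nu) / 2 = - ((1 + nu) / 2) + 1 by field.
  rewrite powRD ?(gt_eqF K0) ?implybT // powRr1 ?ler0n //.
  by rewrite ler_wpM2l ?powR_ge0 // ler_nat leq_addr.
(* The power of [K] in [eta] is the one for which the error term decays at the same rate as the term
   bounded by [Kpow]. *)
have Kexp a : 0 <= a ->
    (a * K%:R `^ ((1 - nu) / 2)) `^ (- ((1 + nu) / (1 - nu))) =
    a `^ (- ((1 + nu) / (1 - nu))) * K%:R `^ (- ((1 + nu) / 2)).
  move=> a0; rewrite powRM ?powR_ge0 // -powRrM; congr (_ * _ `^ _).
  by field; rewrite gt_eqF // subr_gt0.
split=> etaE; apply: (gap delta) => //; rewrite /delta.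
- rewrite [X in _ <= X]mulrDl; apply: lerD.
    rewrite etaE.
    have -> : 125 * (c * K%:R `^ ((1 - nu) / 2)) * D ^+ 2 / (K + 3)%:R =
        125 * c * D ^+ 2 * (K%:R `^ ((1 - nu) / 2) / (K + 3)%:R) by ring.
    by rewrite ler_wpM2l // !mulr_ge0 ?sqr_ge0 // ltW.
  by rewrite etaE (Kexp _ (ltW c0)); lra.
- rewrite !(mulrDl _ _ M, mulrDl _ _ (D `^ _), mulrDl _ _ (K%:R `^ _)).
  apply: lerD.
    rewrite etaE.
    have -> : 125 * (c * K%:R `^ ((1 - nu) / 2) * M * D `^ (nu - 1)) * D ^+ 2
        / (K + 3)%:R = 125 * c * M * (D `^ (nu - 1) * D ^+ 2) *
        (K%:R `^ ((1 - nu) / 2) / (K + 3)%:R) by ring.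
    have -> : D `^ (nu - 1) * D ^+ 2 = D `^ (nu + 1).
      rewrite -powR_mulrn ?ltW // -powRD ?(gt_eqF D_gt0) ?implybT //.
      by congr (_ `^ _); ring.
    by rewrite ler_wpM2l // !mulr_ge0 ?powR_ge0 // ltW.
  have -> : eta = c * (M * D `^ (nu - 1)) * K%:R `^ ((1 - nu) / 2).
    by rewrite etaE; ring.
  have MD0 : 0 <= M * D `^ (nu - 1) by rewrite mulr_ge0 ?powR_ge0 // ltW.
  (* With [eta] scaled by [M * D]^ (nu -
     1)[, the powers of]M[in the error term combine to]M[and that of]D[becomes]D [^ (nu + 1)],
     matching the first term. *)
  rewrite (Kexp _ (mulr_ge0 (ltW c0) MD0)) (powRM _ (ltW c0) MD0).
  rewrite (powRM _ (ltW M_gt0) (powR_ge0 _ _)).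
  rewrite -[(D `^ _) `^ _]powRrM.
  have -> : (nu - 1) * - ((1 + nu) / (1 - nu)) = nu + 1.
    by field; rewrite gt_eqF // subr_gt0.
  have ME : M `^ (2 / (1 - nu)) * M `^ (- ((1 + nu) / (1 - nu))) = M.
    rewrite -powRD ?(gt_eqF M_gt0) ?implybT //.
    rewrite (_ : 2 / (1 - nu) + _ = 1) ?powRr1 ?(ltW M_gt0) //.
    by field; rewrite gt_eqF // subr_gt0.
  by move: (M `^ (2 / _)) (M `^ (- _)) ME => Ma Mb <-; lra.
Qed.
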